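(* Assume: (i) $\mathbf h(\mathbf r_j^T\mathbf x)\in\mathrm{Ran}(\boldsymbol\Xi_j)$ for $j=1,\dots,\bar N$; (ii) the local time-evolution bases are constructed with no truncation, i.e. with energy criterion $\upsilon=1$; (iii) the original and restricted state spaces are isomorphic: $\mathbf P\mathbf R^T=\mathbf R^T\mathbf P=\mathbf I_N$ with $\bar N=N$. Then the local-forecast coarse propagator is exact when applied to the state, i.e. $$\mathcal G_{\mathrm{LF}}(\mathbf x(T^n);T^n,T^{n+1})=\mathcal F(\mathbf x(T^n);T^n,T^{n+1})=\mathbf x(T^{n+1}),\qquad n=0,\dots,M-1.$$
   Context: Let $N,M,\bar m\in\mathbb N$ be positive, $m=\bar m M$, $T_{\mathrm{final}}>0$, $h=T_{\mathrm{final}}/m$, $H=T_{\mathrm{final}}/M=\bar m h$. The fine time instances are $t^i=ih$, $0\le i\le m$, and the coarse time instances are $T^n=nH=t^{\bar m n}$, $0\le n\le M$. The fine propagator propagates a state $\boldsymbol\xi\in\mathbb R^N$ at time $t^i$ to a state $\mathcal F(\boldsymbol\xi;t^i,t^j)\in\mathbb R^N$ at time $t^j$, $0\le i\le j\le m$, and satisfies $\mathcal F(\boldsymbol\xi;t^i,t^k)=\mathcal F(\mathcal F(\boldsymbol\xi;t^i,t^j);t^j,t^k)$ for $0\le i\le j\le k\le m$. Given an initial state $\mathbf x^0\in\mathbb R^N$, the (numerical) state is $\mathbf x(t^i):=\mathcal F(\mathbf x^0;0,t^i)$, $0\le i\le m$. Let $1\le\bar N\le N$. $\mathbf R=[\mathbf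 r_1\ \cdots\ \mathbf r_{\bar N}]\in\mathbb R^{N\times\bar N}$ ($\mathbf R^T$ is the restriction operator) and $\mathbf P\in\mathbb R^{N\times\bar N}$ is the prolongation operator. $\mathbf e_i$ denotes canonical unit vectors, $^+$ the Moore--Penrose pseudoinverse, $\mathrm{Ran}$ the range (column space). For $y:\{t^0,\dots,t^m\}\to\mathbb R$ let $\mathbf h(y)=[y(t^1)-y(t^0)\ \cdots\ y(t^m)-y(t^0)]^T\in\mathbb R^m$; $\mathbf r_j^T\mathbf x$ denotes the function $t^i\mapsto\mathbf r_j^T\mathbf x(t^i)$. For $j=1,\dots,\bar N$, the (global) time-evolution basis $\boldsymbol\Xi_j\in\mathbb R^{m\times a}$ has orthonormal columns. The local time-evolution bases $\boldsymbol\Xi_j^n$, $0\le n\le M-1$, are obtained from $\boldsymbol\Xi_j$ and an energy criterion $\upsilon\in[0,1]$ as follows: let $\mathbf Z^n=[\mathbf e_{\bar m n+1}\ \cdots\ \mathbf e_{\bar m(n+1)}]^T-\mathbf 1_{\bar m}[\mathbf e_{\bar m n}]^T\in\mathbb R^{\bar m\times m}$ (with $\mathbf 1_{\bar m}$ the all-ones vector and $\mathbf e_0:=\mathbf 0$); compute a thin singular value decomposition of $\mathbf Z^n\boldsymbol\Xi_j$ with left singular vectors $\mathbf u_1,\mathbf u_2,\dots$ and singular values $\sigma_1\ge\sigma_2\ge\cdots$; then $\boldsymbol\Xi_j^n=[\mathbf u_1\ \cdots\ \mathbf u_{i^*}]$, where $i^*\geq 1$ is the smallest index with $\sum_{\ell=1}^{i^*}\sigma_\ell\ge\upsilon\sum_{\ell}\sigma_\ell$.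 The memory is a positive integer $\alpha$ with $a\le\alpha\le\bar m$, and $\mathbf Z_0\in\{0,1\}^{\alpha\times\bar m}$ extracts the first $\alpha$ entries of a vector in $\mathbb R^{\bar m}$. Put $\gamma_{ij}^n:=\mathbf e_{\bar m}^T\boldsymbol\Xi_j^n[\mathbf Z_0\boldsymbol\Xi_j^n]^+\mathbf e_i$ ($1\le i\le\alpha$) and $\boldsymbol\Gamma_i^n:=\mathrm{diag}(\gamma_{i1}^n,\dots,\gamma_{i\bar N}^n)$. The local-forecast coarse propagator is $$\mathcal G_{\mathrm{LF}}(\boldsymbol\xi;T^n,T^{n+1})=\mathbf P\mathbf R^T\boldsymbol\xi+\mathbf P\sum_{i=1}^{\alpha}\boldsymbol\Gamma_i^n\left[\mathbf R^T\mathcal F(\boldsymbol\xi;T^n,t^{\bar m n+i})-\mathbf R^T\boldsymbol\xi\right].$$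
   Formalization: The formal statement adds the assumption that Z_0 Ξ_j^n has full column rank for all n and j (unique least-squares forecast); without it the claim fails, e.g. m̄=2, M=N=a=α=1, Ξ_1=e_2, where Z_0 Ξ_1^0=0 and the forecast misses the increment. *)

(* Defs.v *)
From mathcomp Require Import all_boot all_order all_algebra reals.

Set Implicit Arguments.
Unset Strict Implicit.
Unset Printing Implicit Defensive.

Import Order.TTheory GRing.Theory Num.Theory.
Local Open Scope ring_scope.

(* Canonical unit vector e_k with the 1-based numbering of the text; e_0 = 0. *)
Definition evec {R : realType} (m k : nat) : 'cV[R]_m :=
  \col_(l < m) (l.+1 == k)%:R.

Definition in_range {R : realType} (m a : nat) (A : 'M[R]_(m, a))
  (v : 'cV[R]_m) : Prop := exists c : 'cV[R]_a, v = A *m c.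

Definition is_pinv {R : realType} (m n : nat) (A : 'M[R]_(m, n))
  (B : 'M[R]_(n, m)) : bool :=
  [&& A *m B *m A == A, B *m A *m B == B,
      (A *m B)^T == A *m B & (B *m A)^T == B *m A].

Lemma gram_unitmx {R : realType} (m n : nat) (A : 'M[R]_(m, n)) :
  row_free A -> A *m A^T \in unitmx.
Proof.
move=> fA; rewrite -row_free_unit -kermx_eq0; apply/rowV0P => v /sub_kermxP.
rewrite mulmxA => vAA0.
suff vA0 : v *m A = 0 by apply: (row_free_inj fA); rewrite vA0 mul0mx.
have : (v *m A) *m (v *m A)^T = 0 by rewrite trmx_mul mulmxA vAA0 mul0mx.
move/matrixP => /(_ 0 0); rewrite !mxE => /eqP.
rewrite psumr_eq0 => [/allP z|i _]; last by rewrite [_^T i 0]mxE -expr2 sqr_ge0.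
apply/rowP => i; have := z i (mem_index_enum i).
by rewrite [_^T i 0]mxE -expr2 sqrf_eq0 /= => /eqP ->; rewrite [RHS]mxE.
Qed.

Lemma is_pinv_factor {R : realType} (m n r : nat) (C : 'M[R]_(m, r))
  (F : 'M[R]_(r, n)) : row_full C -> row_free F ->
  is_pinv (C *m F) (F^T *m invmx (F *m F^T) *m invmx (C^T *m C) *m C^T).
Proof.
move=> fC fF.
have uF : F *m F^T \in unitmx by apply: gram_unitmx.
have uC : C^T *m C \in unitmx.
  have := @gram_unitmx R _ _ C^T; rewrite trmxK; apply.
  by rewrite /row_free mxrank_tr.
set X := invmx (F *m F^T); set Y := invmx (C^T *m C).
have sX : X^T = X by rewrite /X trmx_inv trmx_mul trmxK.
have sY : Y^T = Y by rewrite /Y trmx_inv trmx_mul trmxK.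
have ABE : C *m F *m (F^T *m X *m Y *m C^T) = C *m Y *m C^T.
  by rewrite !mulmxA -(mulmxA C F) -(mulmxA C _ X) mulmxV // mulmx1.
have BAE : (F^T *m X *m Y *m C^T) *m (C *m F) = F^T *m X *m F.
  by rewrite mulmxA -(mulmxA _ C^T C) -(mulmxA _ Y) mulVmx // mulmx1.
rewrite /is_pinv ABE BAE; apply/and4P; split; apply/eqP.
- by rewrite mulmxA -(mulmxA _ C^T C) -(mulmxA _ Y) mulVmx // mulmx1.
- by rewrite !mulmxA -(mulmxA _ F F^T) -(mulmxA _ X (F *m _)) mulVmx // mulmx1.
- by rewrite !trmx_mul trmxK sY mulmxA.
- by rewrite !trmx_mul trmxK sX mulmxA.
Qed.

Lemma is_pinv_exists {R : realType} (m n : nat) (A : 'M[R]_(m, n)) :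
  exists B, is_pinv A B.
Proof.
have := is_pinv_factor (col_base_full A) (row_base_free A).
by rewrite mulmx_base => h; eexists; exact: h.
Qed.

Definition pinv {R : realType} (m n : nat) (A : 'M[R]_(m, n)) : 'M[R]_(n, m) :=
  xchoose (is_pinv_exists A).

Lemma pinvP {R : realType} (m n : nat) (A : 'M[R]_(m, n)) : is_pinv A (pinv A).
Proof. exact: xchooseP. Qed.

Lemma is_pinv_uniq {R : realType} (m n : nat) (A : 'M[R]_(m, n)) B C :
  is_pinv A B -> is_pinv A C -> B = C.
Proof.
case/and4P => /eqP a1 /eqP a2 /eqP a3 /eqP a4.
case/and4P => /eqP b1 /eqP b2 /eqP b3 /eqP b4.
have AB : A *m B = A *m C.
  rewrite -a3 -{1}b1 -(mulmxA _ A B) trmx_mul a3 b3 mulmxA.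
  by rewrite a1.
have BA : B *m A = C *m A.
  rewrite -a4 -{1}b1 -mulmxA mulmxA trmx_mul b4 a4 -!mulmxA.
  by rewrite (mulmxA A) a1.
by rewrite -a2 -b2 BA -!mulmxA AB.
Qed.

Definition thin_svd {R : realType} (m n : nat) (A : 'M[R]_(m, n))
  (U : 'M[R]_(m, minn m n)) (s : 'rV[R]_(minn m n))
  (V : 'M[R]_(n, minn m n)) : Prop :=
  [/\ U^T *m U = 1%:M, V^T *m V = 1%:M,
      (forall l, 0 <= s 0 l),
      (forall l l' : 'I_(minn m n), (l <= l')%N -> s 0 l' <= s 0 l) &
      A = U *m diag_mx s *m V^T].

Definition meets_energy {R : realType} (k : nat) (upsilon : R) (s : 'rV[R]_k)
  (r : nat) : Prop :=
  upsilon * \sum_(l < k) s 0 l <= \sum_(l < k | (l < r)%N) s 0 l.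

Definition energy_index {R : realType} (k : nat) (upsilon : R) (s : 'rV[R]_k)
  (r : nat) : Prop :=
  [/\ (1 <= r <= k)%N, meets_energy upsilon s r &
      forall r', (1 <= r')%N -> meets_energy upsilon s r' -> (r <= r')%N].

(* An SVD is not unique: this says that B collects the leading left singular
   vectors of some thin SVD of A. *)
Definition truncated_left_basis {R : realType} (m n r : nat) (upsilon : R)
  (A : 'M[R]_(m, n)) (B : 'M[R]_(m, r)) : Prop :=
  exists U s V, [/\ thin_svd A U s V, energy_index upsilon s r &
    exists hr : (r <= minn m n)%N, B = colsub (widen_ord hr) U].

Definition tfine {R : realType} (Tfinal : R) (mbar M i : nat) : R :=
  i%:R * (Tfinal / (mbar * M)%:R).

Definition tcoarse {R : realType} (Tfinal : R) (M n : nat) : R :=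
  n%:R * (Tfinal / M%:R).

(* Propagators take the state, the start time and the end time; only their
   values at grid times matter. *)
Definition fine_propagator {R : realType} (N mbar M : nat) (Tfinal : R)
  (F : 'cV[R]_N -> R -> R -> 'cV[R]_N) : Prop :=
  let t := tfine Tfinal mbar M in
  forall i j k : nat, (i <= j)%N -> (j <= k)%N -> (k <= mbar * M)%N ->
  forall xi, F xi (t i) (t k) = F (F xi (t i) (t j)) (t j) (t k).

Definition state {R : realType} (N : nat)
  (F : 'cV[R]_N -> R -> R -> 'cV[R]_N) (x0 : 'cV[R]_N) (t : R) : 'cV[R]_N :=
  F x0 0 t.

(* h(y); the 0-based row i holds the entry for t^{i+1}. *)
Definition increments {R : realType} (mbar M : nat) (Tfinal : R) (y : R -> R) :
  'cV[R]_(mbar * M) :=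
  \col_(i < mbar * M)
    (y (tfine Tfinal mbar M i.+1) - y (tfine Tfinal mbar M 0)).

(* Z^n: row i maps the increments y(t^l) - y(t^0), l >= 1, to
   y(t^{mbar n + i}) - y(t^{mbar n}). *)
Definition local_increment_mx {R : realType} (mbar M n : nat) :
  'M[R]_(mbar, mbar * M) :=
  \matrix_(i < mbar, l < mbar * M)
    (evec (mbar * M) (mbar * n + i.+1) l 0 - evec (mbar * M) (mbar * n) l 0).

(* Z_0: extracts the first alpha entries when alpha <= mbar. *)
Definition memory_mx {R : realType} (alpha mbar : nat) : 'M[R]_(alpha, mbar) :=
  \matrix_(i < alpha, l < mbar) (i == l :> nat)%:R.

(* gamma_{ij}^n, where X is the local basis Xi_j^n and 1 <= i <= alpha *)
Definition forecast_weight {R : realType} (alpha mbar r : nat)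
  (X : 'M[R]_(mbar, r)) (i : nat) : R :=
  ((evec mbar mbar)^T *m X *m pinv (memory_mx alpha mbar *m X)
     *m evec alpha i) 0 0.

(* Gamma_i^n, where X j is the local basis Xi_j^n, with r j columns *)
Definition forecast_mx {R : realType} (Nbar alpha mbar : nat)
  (r : 'I_Nbar -> nat) (X : forall j, 'M[R]_(mbar, r j)) (i : nat) :
  'M[R]_Nbar :=
  diag_mx (\row_(j < Nbar) forecast_weight alpha (X j) i).

(* G_LF(xi; T^n, T^{n+1}); P is the prolongation, Rm^T the restriction *)
Definition coarse_LF {R : realType} (N Nbar mbar M alpha : nat) (Tfinal : R)
  (F : 'cV[R]_N -> R -> R -> 'cV[R]_N) (P Rm : 'M[R]_(N, Nbar))
  (n : nat) (r : 'I_Nbar -> nat) (X : forall j, 'M[R]_(mbar, r j))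
  (xi : 'cV[R]_N) : 'cV[R]_N :=
  P *m Rm^T *m xi +
  P *m (\sum_(1 <= i < alpha.+1) forecast_mx alpha X i *m
    (Rm^T *m F xi (tcoarse Tfinal M n) (tfine Tfinal mbar M (mbar * n + i))
     - Rm^T *m xi)).

(* Main.v *)
(** On each coarse interval the increments of every component of the restricted
   state are the image under Z^n of its global increments, hence lie in
   Ran(Z^n Xi_j).  Without truncation the discarded singular values vanish, so
   this is contained in Ran(Xi_j^n).  Since Z_0 Xi_j^n has full column rank, the
   least-squares fit on the memory recovers the coefficients exactly, and so its
   last row recovers the increment over the whole coarse interval. *)

Require Import Defs.
From mathcomp Require Import all_boot all_order all_algebra reals.

Set Implicit Arguments.
Unset Strict Implicit.
Unset Printing Implicit Defensive.

Import Order.TTheory GRing.Theory Num.Theory.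
Local Open Scope ring_scope.

(** Full column rank lets [A] be cancelled on the left in the Penrose identity
    [A *m pinv A *m A = A]. *)
Lemma pinv_mulVmx (R : realType) (m n : nat) (A : 'M[R]_(m, n)) :
  row_full A -> pinv A *m A = 1%:M.
Proof.
move=> fA; case/and4P: (pinvP A) => /eqP AVA _ _ _.
by apply: (row_full_inj fA); rewrite mulmx1 mulmxA.
Qed.

Lemma evec_delta (R : realType) (m : nat) (l : 'I_m) :
  evec m l.+1 = delta_mx l 0 :> 'cV[R]_m.
Proof. by apply/colP => i; rewrite !mxE eqSS andbT. Qed.

Lemma evec0 (R : realType) (m : nat) : evec m 0 = 0 :> 'cV[R]_m.
Proof. by apply/colP => i; rewrite !mxE. Qed.

(** Energy level 1 bounds the sum of the discarded singular values by 0. They are nonnegative, so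
    each one is 0, and only the first [r] columns of [U] contribute to [A *m c]. *)
Lemma in_range_no_truncation (R : realType) (m n r : nat) (A : 'M[R]_(m, n))
  (B : 'M[R]_(m, r)) (c : 'cV[R]_n) :
  truncated_left_basis 1 A B -> in_range B (A *m c).
Proof.
case=> U [s [V [[_ _ s_ge0 _ ->] [_ + _] [hr ->]]]].
rewrite /meets_energy mul1r (bigID (fun l : 'I__ => (l < r)%N)) /= => tail_le0.
have s_eq0 (l : 'I_(minn m n)) : (r <= l)%N -> s 0 l = 0.
  move=> le_rl; apply/eqP; rewrite eq_le s_ge0 andbT.
  (* Writing 0 as the leading sum minus itself reduces the claim to the energy inequality and the
     bound of [s 0 l] by the tail sum. *)
  rewrite -[leRHS](subrr (\sum_(l < minn m n | (l < r)%N) s 0 l)).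
  rewrite lerBrDl (le_trans _ tail_le0) // lerD2l.
  by rewrite (bigD1 l) -?leqNgt //= lerDl sumr_ge0.
(* The coordinates of [A *m c] along the left singular vectors, cut to the first [r]. *)
exists (rowsub (widen_ord hr) (diag_mx s *m V^T *m c)).
apply/colP => i; rewrite -!mulmxA !mxE.
rewrite (bigID (fun l : 'I__ => (l < r)%N)) /= addrC big1 ?add0r; last first.
  by move=> l; rewrite -leqNgt => /s_eq0 s0; rewrite mul_diag_mx mxE s0 mul0r mulr0.
rewrite (big_ord_narrow hr); apply: eq_bigr => l _.
by rewrite [colsub _ _ _ _]mxE [in RHS]mxE.
Qed.

Lemma tfine0 (R : realType) (Tfinal : R) (mbar M : nat) :
  tfine Tfinal mbar M 0 = 0.
Proof. by rewrite /tfine mul0r. Qed.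

Lemma tcoarse_tfine (R : realType) (Tfinal : R) (mbar M n : nat) :
  (0 < mbar)%N -> tcoarse Tfinal M n = tfine Tfinal mbar M (mbar * n).
Proof.
move=> mbar_gt0; rewrite /tcoarse /tfine !natrM invfM.
have mbar_neq0 : mbar%:R != 0 :> R by rewrite pnatr_eq0 -lt0n.
by rewrite (mulrC mbar%:R) -mulrA (mulrCA Tfinal) mulVKf.
Qed.

(** The convention that [evec] vanishes at index 0 makes the formula hold at [k = 0] too, as the
    first coarse interval requires. *)
Lemma evec_increments (R : realType) (mbar M k : nat) (Tfinal : R)
  (y : R -> R) : (k <= mbar * M)%N ->
  ((evec (mbar * M) k)^T *m increments mbar M Tfinal y) 0 0
    = y (tfine Tfinal mbar M k) - y (tfine Tfinal mbar M 0).
Proof.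
case: k => [|k] lt_k; first by rewrite evec0 trmx0 mul0mx mxE subrr.
by rewrite (evec_delta _ (Ordinal lt_k)) trmx_delta -rowE !mxE.
Qed.

(** Each row of the matrix is a difference of two rows [(evec _ k)^T], so the reference value at the
    initial time cancels. *)
Lemma local_increment_mxE (R : realType) (mbar M n : nat) (Tfinal : R)
  (y : R -> R) : (n < M)%N ->
  local_increment_mx mbar M n *m increments mbar M Tfinal y =
  \col_(i < mbar) (y (tfine Tfinal mbar M (mbar * n + i.+1))
                   - y (tfine Tfinal mbar M (mbar * n))).
Proof.
move=> lt_nM; apply/colP => i; rewrite [RHS]mxE.
have le_n1 : (mbar * n + mbar <= mbar * M)%N by rewrite -mulnSr leq_mul2l lt_nM orbT.
have -> : y (tfine Tfinal mbar M (mbar * n + i.+1))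
          - y (tfine Tfinal mbar M (mbar * n))
        = (((evec (mbar * M) (mbar * n + i.+1))^T - (evec (mbar * M) (mbar * n))^T)
            *m increments mbar M Tfinal y) 0 0.
  rewrite mulmxBl [RHS]mxE [X in _ = _ + X]mxE !evec_increments.
  - by rewrite opprB addrA subrK.
  - exact: leq_trans (leq_addr _ _) le_n1.
  - by apply: leq_trans le_n1; rewrite leq_add2l.
by rewrite [LHS]mxE [RHS]mxE; apply: eq_bigr => l _; rewrite !mxE.
Qed.

Lemma forecast_exact (R : realType) (alpha mbar r : nat)
  (X : 'M[R]_(mbar, r)) (g : nat -> R) :
  (0 < mbar)%N -> (alpha <= mbar)%N -> row_full (memory_mx alpha mbar *m X) ->
  in_range X (\col_(i < mbar) g i.+1) ->
  \sum_(1 <= i < alpha.+1) forecast_weight alpha X i * g i = g mbar.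
Proof.
move=> mbar_gt0 le_am fX [c gE]; rewrite big_add1 big_mkord.
have memory_g : memory_mx alpha mbar *m (\col_(i < mbar) g i.+1)
              = \col_(i < alpha) g i.+1.
  apply/colP => i; rewrite !mxE (bigD1 (widen_ord le_am i)) //= !mxE eqxx mul1r.
  by rewrite big1 ?addr0 // => l ne_l; rewrite !mxE eq_sym (negPf (ne_l : l != i :> nat)) mul0r.
(* A successor dimension provides the index [ord_max] of the last row. *)
case: mbar mbar_gt0 => // m _ in X le_am fX gE memory_g *.
(* The weights are the entries of a single row vector, here applied to the memory data. *)
transitivity (((evec m.+1 m.+1)^T *m X *m pinv (memory_mx alpha m.+1 *m X)
               *m \col_(i < alpha) g i.+1) 0 0).
  rewrite [RHS]mxE; apply: eq_bigr => i _.
  by rewrite /forecast_weight evec_delta -colE !mxE.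
rewrite -memory_g gE -!mulmxA (mulmxA (memory_mx _ _)).
rewrite (mulmxA (pinv _)) pinv_mulVmx // mul1mx -gE.
by rewrite (evec_delta _ (@ord_max m)) trmx_delta -rowE !mxE.
Qed.

Theorem theorem4p3 (R : realType) (N Nbar M mbar a alpha : nat) (Tfinal : R)
  (F : 'cV[R]_N -> R -> R -> 'cV[R]_N) (x0 : 'cV[R]_N)
  (Rm P : 'M[R]_(N, Nbar))
  (Xi : 'I_Nbar -> 'M[R]_(mbar * M, a)) (upsilon : R)
  (r : 'I_M -> 'I_Nbar -> nat)
  (Xiloc : forall (n : 'I_M) (j : 'I_Nbar), 'M[R]_(mbar, r n j))
  (N_gt0 : (0 < N)%N) (M_gt0 : (0 < M)%N) (mbar_gt0 : (0 < mbar)%N)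
  (Tfinal_gt0 : 0 < Tfinal)
  (Nbar_bounds : (1 <= Nbar <= N)%N)
  (F_fine : fine_propagator mbar M Tfinal F)
  (Xi_orthonormal : forall j, (Xi j)^T *m Xi j = 1%:M)
  (upsilon_bounds : 0 <= upsilon <= 1)
  (Xiloc_basis : forall (n : 'I_M) (j : 'I_Nbar), truncated_left_basis upsilon
     (local_increment_mx mbar M n *m Xi j) (Xiloc n j))
  (alpha_gt0 : (0 < alpha)%N)
  (alpha_bounds : (a <= alpha <= mbar)%N)
  (* well-posedness of the least-squares forecast: full column rank *)
  (memory_full_rank : forall (n : 'I_M) (j : 'I_Nbar),
     \rank (memory_mx alpha mbar *m Xiloc n j) = r n j)
  (h_in_range : forall j : 'I_Nbar, in_range (Xi j)
     (increments mbar M Tfinal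
        (fun t => ((col j Rm)^T *m state F x0 t) 0 0)))
  (no_truncation : upsilon = 1)
  (Nbar_eq : Nbar = N)
  (PR_id : P *m Rm^T = 1%:M) (RP_id : Rm^T *m P = 1%:M) :
  forall n : 'I_M,
    let x := state F x0 in
    let T := tcoarse Tfinal M in
    coarse_LF M alpha Tfinal F P Rm n (Xiloc n) (x (T n))
      = F (x (T n)) (T n) (T n.+1) /\
    F (x (T n)) (T n) (T n.+1) = x (T n.+1).
Proof.
move=> n x T.
have TE k : T k = tfine Tfinal mbar M (mbar * k) by apply: tcoarse_tfine.
have le_n1 : (mbar * n + mbar <= mbar * M)%N.
  by rewrite -mulnSr leq_mul2l ltn_ord orbT.
(* Restarting from the state at [T n] stays on the trajectory from time 0; reading 0 as a grid time
   lets the composition law apply. *)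
have xE i : (i <= mbar)%N -> F (x (T n)) (T n) (tfine Tfinal mbar M (mbar * n + i))
                             = x (tfine Tfinal mbar M (mbar * n + i)).
  move=> le_i; rewrite /x /state TE -(tfine0 Tfinal mbar M) -F_fine ?leq_addr //.
  by apply: leq_trans le_n1; rewrite leq_add2l.
have TS : T n.+1 = tfine Tfinal mbar M (mbar * n + mbar) by rewrite TE mulnSr.
have FxE : F (x (T n)) (T n) (T n.+1) = x (T n.+1) by rewrite TS xE.
split=> //; rewrite FxE /coarse_LF -mulmxA -mulmxDr.
(* Since [P *m Rm^T] is the identity, it suffices to compare restricted states. *)
rewrite -[RHS]mul1mx -PR_id -mulmxA; congr (P *m _).
rewrite -[RHS](subrKC (Rm^T *m x (T n))); congr (_ + _).
case/andP: alpha_bounds => _ le_am.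
(* The forecast matrices are diagonal, so each component is a separate scalar forecast. *)
apply/colP => j; pose y t := ((col j Rm)^T *m x t) 0 0.
have yE t : (Rm^T *m x t) j 0 = y t.
  by rewrite /y tr_col -row_mul [RHS]mxE.
pose g i := y (tfine Tfinal mbar M (mbar * n + i)) - y (T n).
have -> : (Rm^T *m x (T n.+1) - Rm^T *m x (T n)) j 0 = g mbar.
  by rewrite mxE [X in _ + X]mxE !yE TS.
rewrite summxE -(@forecast_exact _ alpha _ _ (Xiloc n j) g) //.
- apply: eq_big_nat => i /andP[_ le_i]; rewrite /forecast_mx mul_diag_mx !mxE.
  by rewrite xE ?(leq_trans _ le_am) // /g -!yE !mxE.
- by rewrite /row_full memory_full_rank.
have [c hE] := h_in_range j.
have -> : \col_(i < mbar) g i.+1 = local_increment_mx mbar M n *m Xi j *m c.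
  by rewrite -mulmxA -hE local_increment_mxE // /g TE.
by apply: in_range_no_truncation; rewrite -no_truncation.
Qed.
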